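(* Let $\varphi$ be an Orlicz function (with $Ces_\varphi[0,\infty)\ne\{0\}$). (i) In the case when $\varphi(b_\varphi)=\infty$, assume that there exists a constant $D>0$ such that $$\rho_\varphi(f)\le D\,I_\varphi(f)$$ for all $f\in KL^\varphi[0,\infty)$. (No such assumption is made when $\varphi(b_\varphi)<\infty$.) If $\varphi\notin\Delta_2(\mathbb R_+)$, then $Ces_\varphi[0,\infty)$ contains an order isomorphically isometric copy of $l^\infty$. (ii) If $\varphi\in\Delta_2(\mathbb R_+)$, then $Ces_\varphi[0,\infty)$ does not contain an order isomorphic copy of $l^\infty$.
   Context: Here $I=[0,\infty)$ with Lebesgue measure $\mu$, and $L^0(I)$ is the space of (classes of a.e. equal) real-valued Lebesgue measurable functions on $I$. An Orlicz function is a function $\varphi:[0,\infty)\to[0,\infty]$ that is convex, satisfies $\varphi(0)=0$, is neither identically $0$ nor identically $\infty$ on $(0,\infty)$, and is left continuous on $(0,\infty)$, i.e. $\lim_{u\to b_\varphi^-}\varphi(u)=\varphi(b_\varphi)$ if $b_\varphi<\infty$, where $b_\varphi=\sup\{u>0:\varphi(u)<\infty\}$. Put $a_\varphi=\sup\{u\ge0:\varphi(u)=0\}$. It is assumed throughout that if $b_\varphi<\infty$ then $a_\varphi<b_\varphi$. If $b_\varphi=\infty$, then $\varphi(b_\varphi)$ means $\lim_{u\to\infty}\varphi(u)=\infty$, so the case $\varphi(b_\varphi)=\infty$ includes $b_\varphi=\infty$. $\varphi\in\Delta_2(\mathbb R_+)$ means that there is $K>0$ with $\varphi(2u)\le K\varphi(u)$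 for all $u\ge0$. For $f\in L^0(I)$: $I_\varphi(f)=\int_I\varphi(|f(t)|)\,dt$; the Cesàro operator is $Cf(x)=\frac1x\int_0^xf(t)\,dt$ for $0<x\in I$; $\rho_\varphi(f)=I_\varphi(C|f|)$. The Orlicz class is $KL^\varphi(I)=\{f\in L^0(I):I_\varphi(f)<\infty\}$. The Cesàro–Orlicz space is $Ces_\varphi(I)=\{f\in L^0(I):\rho_\varphi(f/\lambda)<\infty\text{ for some }\lambda>0\}$ with norm $\|f\|_{Ces(\varphi)}=\inf\{\lambda>0:\rho_\varphi(f/\lambda)\le1\}$ and the a.e. pointwise order. A Banach function space $E$ contains an order isomorphic copy of $l^\infty$ if there is a linear map $T:l^\infty\to E$ that is an isomorphism onto its range (i.e. $c\|x\|\le\|Tx\|\le c'\|x\|$ for some $c,c'>0$) and satisfies $x\ge0\iff Tx\ge0$; it contains an order isomorphically isometric copy of $l^\infty$ if $T$ can moreover be chosen isometric. *)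

(* Defs.v *)
From HB Require Import structures.
From mathcomp Require Import all_boot all_order all_algebra.
From mathcomp Require Import all_classical all_reals all_analysis.

Set Implicit Arguments.
Unset Strict Implicit.
Unset Printing Implicit Defensive.
Import Order.TTheory GRing.Theory Num.Theory.
Import numFieldNormedType.Exports.

Local Open Scope classical_set_scope.
Local Open Scope ring_scope.

(* The real line with the sigma-algebra of Lebesgue measurable sets, i.e. the
   domain of completed_lebesgue_measure; it is convertible to R. *)
Notation lebR R := (caratheodory_type ((@wlength R idfun)^*)%mu).

Notation leb R := (@completed_lebesgue_measure R).

Definition halfline (R : realType) : set (lebR R) := `[0%R, +oo[%classic.
Arguments halfline : clear implicits.

(* Elements of L^0 are represented by functions on R of which only the
   restriction to [0, +oo[ matters, and that only up to a.e. equality. *)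
Definition L0 (R : realType) : set (lebR R -> R) :=
  [set f | measurable_fun (halfline R) f].

Section orlicz.
Context {R : realType}.
Implicit Types phi : R -> \bar R.
Local Open Scope ereal_scope.

(* Only the values of phi on [0, +oo[ are meaningful. In the convexity
   inequality, 0 * +oo = 0. *)
Record orlicz_function phi : Prop := OrliczFunction {
  orlicz_ge0 : forall u : R, (0 <= u)%R -> 0 <= phi u ;
  orlicz0 : phi 0%R = 0 ;
  orlicz_convex : forall s u v : R, (0 <= s <= 1)%R -> (0 <= u)%R -> (0 <= v)%R ->
    phi (s * u + (1 - s) * v)%R <= s%:E * phi u + (1 - s)%:E * phi v ;
  orlicz_not0 : exists2 u : R, (0 < u)%R & phi u != 0 ;
  orlicz_notoo : exists2 u : R, (0 < u)%R & phi u != +oo ;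
  orlicz_left_continuous : forall u : R, (0 < u)%R ->
    phi x @[x --> u^'-] --> phi u }.

Definition orlicz_a phi : \bar R :=
  ereal_sup [set u%:E | u in [set u : R | (0 <= u)%R /\ phi u = 0]].

Definition orlicz_b phi : \bar R :=
  ereal_sup [set u%:E | u in [set u : R | (0 < u)%R /\ phi u < +oo]].

(* An Orlicz function tends to +oo at +oo. The value at -oo is irrelevant. *)
Definition orlicz_ext phi (u : \bar R) : \bar R :=
  match u with
  | r%:E => phi r
  | _ => +oo
  end.

Definition Delta2 phi : Prop :=
  exists2 K : R, (0 < K)%R &
    forall u : R, (0 <= u)%R -> phi (2 * u)%R <= K%:E * phi u.

Definition orlicz_modular phi (g : lebR R -> \bar R) : \bar R :=
  \int[leb R]_(t in halfline R) orlicz_ext phi `|g t|.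

Definition cesaro_op (f : lebR R -> R) (x : lebR R) : \bar R :=
  ((x : R)^-1)%:E * \int[leb R]_(t in `[0%R, (x : R)]%classic) (f t)%:E.

Definition rho phi (f : lebR R -> R) : \bar R :=
  orlicz_modular phi (cesaro_op (fun t => `|f t|%R)).

Definition orlicz_class phi : set (lebR R -> R) :=
  [set f | L0 f /\ orlicz_modular phi (EFin \o f) < +oo].

Definition Ces phi : set (lebR R -> R) :=
  [set f | L0 f /\
     exists2 l : R, (0 < l)%R & rho phi (fun t => f t / l)%R < +oo].

Definition Ces_norm phi (f : lebR R -> R) : R :=
  inf [set l : R | (0 < l)%R /\ rho phi (fun t => f t / l)%R <= 1].

Definition Ces_nontrivial phi : Prop :=
  exists2 f, Ces phi f & ~ {ae leb R, forall t, halfline R t -> f t = 0%R}.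

End orlicz.

Section linfty.
Context {R : realType}.
Implicit Types (phi : R -> \bar R) (x y : nat -> R).

Definition linfty : set (nat -> R) := bounded_fun.

Definition linfty_norm x : R := sup (range (fun n => `|x n|)).

(* T is given by representatives, so linearity and order hold a.e. *)
Record order_isomorphic_embedding phi (T : (nat -> R) -> (lebR R -> R)) : Prop :=
  OrderIsomorphicEmbedding {
  embed_Ces : forall x, linfty x -> Ces phi (T x) ;
  embed_linear : forall (a : R) x y, linfty x -> linfty y ->
    {ae leb R, forall t, halfline R t ->
      T (fun n => a * x n + y n) t = a * T x t + T y t} ;
  embed_order : forall x, linfty x ->
    (forall n, 0 <= x n) <->
    {ae leb R, forall t, halfline R t -> 0 <= T x t} ;
  embed_iso : exists c c' : R, [/\ 0 < c, 0 < c' & forall x, linfty x ->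
    c * linfty_norm x <= Ces_norm phi (T x) <= c' * linfty_norm x] }.

Definition contains_linfty phi : Prop :=
  exists T, order_isomorphic_embedding phi T.

Definition contains_linfty_isometrically phi : Prop :=
  exists2 T, order_isomorphic_embedding phi T &
    forall x, linfty x -> Ces_norm phi (T x) = linfty_norm x.

End linfty.

(* Main.v *)
Require Import Defs.
From mathcomp Require Import all_boot all_order all_algebra.
From mathcomp Require Import all_classical all_reals all_analysis.
From mathcomp Require Import measurable_realfun ring lra.

(** Everything rests on the superadditivity phi u + phi v <= phi (u + v), which
    the Cesaro modular rho inherits (rho_superadd).

    Under Delta_2, let T be an order isomorphic embedding of l^oo. The images of
    the unit vectors are nonnegative and their finite sums stay below T 1; their
    norms are bounded below, so for a suitable l each of them has modular at
    least 1 after division by l. Superadditivity forces rho (T 1 / l) = +oo,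
    whereas Delta_2 makes rho finite on all multiples of T 1
    (Delta2_no_linfty).

    Without Delta_2, a copy of l^oo is spanned by functions
    f_n = sum_(k in N_n) u_k 1_]p_k,q_k] over disjoint intervals, for a partition
    of the indices k into infinite classes N_n. The copy is isometric as soon as
    F = sum_k u_k 1_]p_k,q_k] satisfies rho F <= 1, while every dilation by r > 1
    of a block of large index has modular above 1 (blocks_linfty). The
    difficulty is that averaging destroys a function supported far from 0
    relative to its length. It is overcome by lacunarity: if p_k is much
    smaller than q_k, then the Cesaro mean of the k-th block is nearly u_k on
    [q_k/2, q_k] (rho_ge_itv), and it remains to find u_k and q_k for which
    q_k phi (u_k) is small and q_k phi ((1 + 1/(k+1)) u_k) is large, with the q_k
    tending to 0 or to +oo as fast as desired.

    If phi(b) = +oo, the failure of Delta_2 at every dilation factor above 1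
    provides them (not_Delta2_blocks), and rho F <= D I_phi F <= 1. If phi(b) is
    finite, take u_k = b and q_k tending to 0 inside a short interval [0, d];
    then F <= b 1_[0,d], and the nontriviality of the space bounds the tail
    of the modular (small_support_rho). *)

Set Implicit Arguments.
Unset Strict Implicit.
Unset Printing Implicit Defensive.
Import Order.TTheory GRing.Theory Num.Theory.
Import numFieldNormedType.Exports.

Local Open Scope classical_set_scope.
Local Open Scope ring_scope.
Local Open Scope ereal_scope.

(** * Orlicz functions *)

Section orlicz_function_theory.
Context {R : realType} (phi : R -> \bar R) (hphi : orlicz_function phi).

Lemma orlicz_scale (s u : R) : (0 <= s <= 1)%R -> (0 <= u)%R ->
  phi (s * u)%R <= s%:E * phi u.
Proof.
move=> s01 u0; have := orlicz_convex hphi s01 u0 (lexx 0%R).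
by rewrite mulr0 addr0 (orlicz0 hphi) mule0 adde0.
Qed.

(** With w = u + v, convexity and phi 0 = 0 put phi below the chord from the
    origin to (w, phi w) at both u and v, and the two chord values add up to
    phi w. *)
Lemma orlicz_superadd (u v : R) : (0 <= u)%R -> (0 <= v)%R ->
  phi u + phi v <= phi (u + v)%R.
Proof.
move=> u0 v0; have [uv0|uv0] := eqVneq (u + v)%R 0%R.
  have -> : u = 0%R by lra.
  have -> : v = 0%R by lra.
  by rewrite addr0 (orlicz0 hphi) adde0.
set w := (u + v)%R in uv0 *.
have w0 : (0 < w)%R by rewrite lt_neqAle eq_sym uv0 addr_ge0.
have split_w z : (0 <= z <= w)%R -> phi z <= (z / w)%:E * phi w.
  move=> /andP[z0 zw]; rewrite -{1}(divfK uv0 z) orlicz_scale ?(ltW w0)//.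
  by rewrite divr_ge0 ?(ltW w0)// ler_pdivrMr// mul1r.
have /split_w hu : (0 <= u <= w)%R by rewrite u0 lerDl.
have /split_w hv : (0 <= v <= w)%R by rewrite v0 lerDr.
rewrite (le_trans (leeD hu hv))// -ge0_muleDl ?lee_fin ?divr_ge0 ?(ltW w0)//.
by rewrite -EFinD -mulrDl divff// mul1e.
Qed.

Lemma le_orlicz (u v : R) : (0 <= u)%R -> (u <= v)%R -> phi u <= phi v.
Proof.
move=> u0 uv; rewrite -(subrK u v) addrC.
apply: le_trans (orlicz_superadd u0 _); last by rewrite subr_ge0.
by rewrite leeDl// (orlicz_ge0 hphi)// subr_ge0.
Qed.

Lemma orlicz_ext_ge0 (x : \bar R) : 0 <= x -> 0 <= orlicz_ext phi x.
Proof. by case: x => //= r; rewrite lee_fin; exact: orlicz_ge0. Qed.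

Lemma le_orlicz_ext (x y : \bar R) : 0 <= x -> x <= y ->
  orlicz_ext phi x <= orlicz_ext phi y.
Proof.
by case: x => [r| |] //; case: y => [s| |] //= r0 rs; rewrite ?leey// le_orlicz.
Qed.

Lemma orlicz_ext_superadd (x y : \bar R) : 0 <= x -> 0 <= y ->
  orlicz_ext phi x + orlicz_ext phi y <= orlicz_ext phi (x + y).
Proof.
case: x => [r| |] //; case: y => [s| |] //= r0 s0; rewrite ?leey//.
exact: orlicz_superadd.
Qed.

End orlicz_function_theory.

(** * Lebesgue measurable sets and functions *)

Section lebesgue_sets.
Context {R : realType}.

Lemma leb_measurable (A : set R) : measurable A -> measurable (A : set (lebR R)).
Proof. by move=> mA; apply: sub_caratheodory; exact: mA. Qed.

Lemma leb_measurable_itv (i : interval R) : measurable ([set` i] : set (lebR R)).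
Proof. by apply: leb_measurable; exact: measurable_itv. Qed.

Lemma leb_itv (i : interval R) : leb R [set` i] = lebesgue_measure [set` i].
Proof. by []. Qed.

Lemma measurable_halfline : measurable (halfline R).
Proof. exact: leb_measurable_itv. Qed.

Lemma sub_halfline (a b : bool) (p q : R) : (0 <= p)%R ->
  [set` Interval (BSide a p) (BSide b q)] `<=` (halfline R).
Proof.
move=> p0 t; rewrite /halfline /= !in_itv/= andbT => /andP[+ _].
by case: a => /= pt; rewrite (le_trans p0)// ltW.
Qed.

Lemma L0_scale (f : lebR R -> R) (k : R) : L0 f -> L0 (fun t => f t / k)%R.
Proof. by move=> mf; apply: measurable_funM => //; exact: measurable_cst. Qed.

Lemma L0_mull (f : lebR R -> R) (k : R) : L0 f -> L0 (fun t => k * f t)%R.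
Proof. by move=> mf; apply: measurable_funM => //; exact: measurable_cst. Qed.

Lemma L0_abs (f : lebR R -> R) : L0 f -> measurable_fun (halfline R) (fun t => (`|f t|)%:E).
Proof. by move=> mf; apply/measurable_EFinP; apply: measurableT_comp mf. Qed.

End lebesgue_sets.

(** * The modular of a Cesaro mean *)

Lemma ae_ge0_integral_superadd d (T : measurableType d) (R : realType)
    (mu : {measure set T -> \bar R}) (D : set T) (f g h : T -> \bar R) :
  measurable D ->
  measurable_fun D f -> measurable_fun D g -> measurable_fun D h ->
  (forall x, D x -> 0 <= f x) -> (forall x, D x -> 0 <= g x) ->
  (forall x, D x -> 0 <= h x) ->
  {ae mu, forall x, D x -> f x + g x <= h x} ->
  \int[mu]_(x in D) f x + \int[mu]_(x in D) g x <= \int[mu]_(x in D) h x.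
Proof.
move=> mD mf mg mh f0 g0 h0 fgh; rewrite -ge0_integralD//.
apply: ae_ge0_le_integral => //; last exact: emeasurable_funD.
by move=> x Dx; rewrite adde_ge0 ?f0 ?g0.
Qed.

Lemma ge0_le_integral_add d (T : measurableType d) (R : realType)
    (mu : {measure set T -> \bar R}) (D : set T) (f g h : T -> \bar R) :
  measurable D ->
  measurable_fun D f -> measurable_fun D g -> measurable_fun D h ->
  (forall x, D x -> 0 <= f x) -> (forall x, D x -> 0 <= g x) ->
  (forall x, D x -> 0 <= h x) ->
  (forall x, D x -> h x <= f x + g x) ->
  \int[mu]_(x in D) h x <= \int[mu]_(x in D) f x + \int[mu]_(x in D) g x.
Proof.
move=> mD mf mg mh f0 g0 h0 hfg; rewrite -ge0_integralD//.
apply: ge0_le_integral => //; exact: emeasurable_funD.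
Qed.

(** A superlevel set of a nondecreasing h is a ray of [0, +oo], open or closed
    according to whether its infimum c belongs to it, so its preimage under k is
    {c <= k} or {c < k}. It serves twice, with h the primitive of |f| and with
    h = phi. *)
Lemma measurable_nondecreasing_comp d (T : measurableType d) (R : realType)
    (D : set T) (k : T -> \bar R) (h : \bar R -> \bar R) :
  measurable D -> measurable_fun D k -> (forall x, D x -> 0 <= k x) ->
  (forall x y, 0 <= x -> x <= y -> h x <= h y) ->
  measurable_fun D (h \o k).
Proof.
move=> mD mk k0 nd_h.
apply: (measurability (@ErealGenCInfty.G R)) => [|/= _ [_] [r] -> <-].
  exact: ErealGenCInfty.measurableE.
set S : set (\bar R) := [set y | 0 <= y /\ r%:E <= h y].
have [Sc|Sc] := pselect (S (ereal_inf S)).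
  rewrite (_ : _ `&` _ = D `&` [set x | ereal_inf S <= k x]).
    exact: emeasurable_fun_c_infty.
  apply/seteqP; split=> x [Dx] /=; rewrite ?in_itv/= ?andbT => kx; split => //.
    by apply: ereal_inf_lbound; split => //; exact: k0.
  by rewrite (le_trans Sc.2)// nd_h// Sc.1.
rewrite (_ : _ `&` _ = D `&` [set x | ereal_inf S < k x]).
  exact: emeasurable_fun_o_infty.
apply/seteqP; split=> x [Dx] /=; rewrite ?in_itv/= ?andbT => kx; split => //.
  have Skx : S (k x) by split => //; exact: k0.
  rewrite lt_neqAle ereal_inf_lbound// andbT.
  by apply/eqP => kxE; apply: Sc; rewrite kxE.
have [y [y0 ry] yk] := ereal_inf_lt kx.
by rewrite (le_trans ry)// nd_h// ltW.
Qed.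

Section cesaro.
Context {R : realType}.
Implicit Types f g h : lebR R -> R.

Lemma measurable_inv_halfline :
  measurable_fun (halfline R) (fun x : lebR R => ((x : R)^-1)%:E).
Proof.
have : measurable_fun (`[0%R, +oo[%classic : set R) (fun x : R => x^-1)%R.
  apply/measurable_fun_itv_obnd_cbndP.
  apply: open_continuous_measurable_fun; first exact: interval_open.
  move=> x; rewrite inE/= in_itv/= andbT => x0.
  by apply: inv_continuous; rewrite gt_eqF.
move=> mi; apply/measurable_EFinP => _ B mB.
by apply: leb_measurable; apply: mi => //; exact: measurable_itv.
Qed.

Lemma measurable_abs_itv f (x : R) : L0 f ->
  measurable_fun (`[0%R, x]%classic : set (lebR R)) (fun t => (`|f t|)%:E).
Proof.
move=> mf; apply: measurable_funS (L0_abs mf); first exact: measurable_halfline.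
exact: sub_halfline.
Qed.

Lemma measurable_primitive f : L0 f -> measurable_fun (halfline R)
  (fun x : lebR R => \int[leb R]_(t in `[0%R, (x : R)]%classic) (`|f t|)%:E).
Proof.
move=> mf.
pose h (y : \bar R) := if y is x%:E
  then \int[leb R]_(t in `[0%R, x]%classic) (`|f t|)%:E else +oo.
apply: (@measurable_nondecreasing_comp _ _ _ _ (@EFin R : lebR R -> _) h).
- exact: measurable_halfline.
- apply/measurable_EFinP => _ B mB.
  apply: measurableI; first exact: measurable_halfline.
  exact: leb_measurable.
- by move=> x; rewrite /halfline/= in_itv/= andbT lee_fin.
move=> [x| |] [y| |]//; rewrite ?leey// !lee_fin => x0 xy.
apply: ge0_subset_integral.
- exact: leb_measurable_itv.
- exact: leb_measurable_itv.
- exact: measurable_abs_itv.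
- by move=> t _; rewrite lee_fin.
- by apply: subset_itvl; rewrite bnd_simp.
Qed.

Lemma measurable_cesaro f : L0 f ->
  measurable_fun (halfline R) (cesaro_op (fun t => `|f t|)%R).
Proof.
move=> mf; apply: emeasurable_funM; first exact: measurable_inv_halfline.
exact: measurable_primitive.
Qed.

Lemma cesaro_ge0 f (x : lebR R) : halfline R x ->
  0 <= cesaro_op (fun t => `|f t|)%R x.
Proof.
rewrite /halfline/= in_itv/= andbT => x0.
by rewrite mule_ge0// ?lee_fin ?invr_ge0// integral_ge0// => t _; rewrite lee_fin.
Qed.

Lemma cesaro_superadd f g h (x : lebR R) : L0 f -> L0 g -> L0 h ->
  {ae leb R, forall t, halfline R t -> (`|f t| + `|g t| <= `|h t|)%R} ->
  halfline R x ->
  cesaro_op (fun t => `|f t|)%R x + cesaro_op (fun t => `|g t|)%R x <=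
  cesaro_op (fun t => `|h t|)%R x.
Proof.
move=> mf mg mh fgh; rewrite /halfline/= in_itv/= andbT => x0.
rewrite /cesaro_op -ge0_muleDr; last 2 first.
- by apply: integral_ge0 => t _; rewrite lee_fin.
- by apply: integral_ge0 => t _; rewrite lee_fin.
rewrite lee_wpmul2l ?lee_fin ?invr_ge0//.
apply: ae_ge0_integral_superadd.
- exact: leb_measurable_itv.
- exact: measurable_abs_itv.
- exact: measurable_abs_itv.
- exact: measurable_abs_itv.
- by move=> t _; rewrite lee_fin.
- by move=> t _; rewrite lee_fin.
- by move=> t _; rewrite lee_fin.
apply: filterS fgh => t /[swap] tx.
by rewrite -EFinD lee_fin; apply; exact: sub_halfline tx.
Qed.

End cesaro.

Section modular.
Context {R : realType} (phi : R -> \bar R) (hphi : orlicz_function phi).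
Implicit Types f g h : lebR R -> R.

Lemma rhoE f : rho phi f =
  \int[leb R]_(x in halfline R) orlicz_ext phi (cesaro_op (fun t => `|f t|)%R x).
Proof.
by apply: eq_integral => x; rewrite inE => xh; rewrite gee0_abs// cesaro_ge0.
Qed.

Lemma measurable_orlicz_cesaro f : L0 f -> measurable_fun (halfline R)
  (fun x => orlicz_ext phi (cesaro_op (fun t => `|f t|)%R x)).
Proof.
move=> mf; apply: (@measurable_nondecreasing_comp _ _ _ _ _ (orlicz_ext phi)).
- exact: measurable_halfline.
- exact: measurable_cesaro.
- by move=> x; exact: cesaro_ge0.
- by move=> x y; exact: le_orlicz_ext.
Qed.

Lemma orlicz_cesaro_ge0 f (x : lebR R) : halfline R x ->
  0 <= orlicz_ext phi (cesaro_op (fun t => `|f t|)%R x).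
Proof. by move=> xh; rewrite orlicz_ext_ge0// cesaro_ge0. Qed.

Lemma rho_ge0 f : 0 <= rho phi f.
Proof. by rewrite rhoE; apply: integral_ge0 => x; exact: orlicz_cesaro_ge0. Qed.

(** The Cesaro operator is linear and monotone on nonnegative functions, and phi
    is superadditive, so the superadditivity passes to the modular. With g = 0
    it gives the monotonicity of rho. *)
Lemma rho_superadd f g h : L0 f -> L0 g -> L0 h ->
  {ae leb R, forall t, halfline R t -> (`|f t| + `|g t| <= `|h t|)%R} ->
  rho phi f + rho phi g <= rho phi h.
Proof.
move=> mf mg mh fgh; rewrite !rhoE; apply: ae_ge0_integral_superadd.
- exact: measurable_halfline.
- exact: measurable_orlicz_cesaro.
- exact: measurable_orlicz_cesaro.
- exact: measurable_orlicz_cesaro.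
- by move=> x; exact: orlicz_cesaro_ge0.
- by move=> x; exact: orlicz_cesaro_ge0.
- by move=> x; exact: orlicz_cesaro_ge0.
apply: aeW => x xh.
rewrite (le_trans (orlicz_ext_superadd hphi _ _)) ?cesaro_ge0//.
by rewrite (le_orlicz_ext hphi) ?adde_ge0 ?cesaro_ge0// cesaro_superadd.
Qed.

Lemma le_rho f g : L0 f -> L0 g ->
  (forall t, halfline R t -> (`|f t| <= `|g t|)%R) -> rho phi f <= rho phi g.
Proof.
move=> mf mg fg; have m0 : L0 (fun _ : lebR R => 0%R) by exact: measurable_cst.
apply: le_trans (rho_superadd mf m0 mg _); first by rewrite leeDl ?rho_ge0.
by apply: aeW => t th; rewrite normr0 addr0 fg.
Qed.

End modular.

(** * No copy of l^oo under the Delta_2 condition *)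

Section scaling.
Context {R : realType} (phi : R -> \bar R) (hphi : orlicz_function phi).
Implicit Types f g : lebR R -> R.

Lemma cesaro_scale (k : R) f (x : lebR R) : L0 f -> (0 <= k)%R ->
  cesaro_op (fun t => `|k * f t|)%R x = k%:E * cesaro_op (fun t => `|f t|)%R x.
Proof.
move=> mf k0; rewrite /cesaro_op muleCA; congr (_ * _).
under eq_integral do rewrite normrM (ger0_norm k0) EFinM.
apply: ge0_integralZl.
- exact: leb_measurable_itv.
- exact: measurable_abs_itv.
- by move=> t _; rewrite lee_fin.
- by rewrite lee_fin.
Qed.

Lemma rho_double f (K : R) : L0 f -> (0 < K)%R ->
  (forall u : R, (0 <= u)%R -> phi (2 * u)%R <= K%:E * phi u) ->
  rho phi (fun t => 2 * f t)%R <= K%:E * rho phi f.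
Proof.
move=> mf K0 hK.
have m2f : L0 (fun t => 2 * f t)%R by exact: L0_mull.
rewrite !rhoE.
have <- : \int[leb R]_(x in halfline R)
    (K%:E * orlicz_ext phi (cesaro_op (fun t => `|f t|)%R x)) =
    K%:E * \int[leb R]_(x in halfline R)
    orlicz_ext phi (cesaro_op (fun t => `|f t|)%R x).
  apply: ge0_integralZl.
  - exact: measurable_halfline.
  - exact: (measurable_orlicz_cesaro hphi).
  - by move=> x xh; apply: (orlicz_cesaro_ge0 hphi).
  - by rewrite lee_fin ltW.
apply: ge0_le_integral.
- exact: measurable_halfline.
- by move=> x xh; apply: (orlicz_cesaro_ge0 hphi).
- exact: (measurable_orlicz_cesaro hphi).
- by apply: emeasurable_funM; [exact: measurable_cst|
                               exact: (measurable_orlicz_cesaro hphi)].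
move=> x xh; rewrite cesaro_scale//; move: (cesaro_ge0 f xh).
case: (cesaro_op _ _) => [r| |]//; rewrite ?lee_fin.
- exact: hK.
- by move=> _; rewrite !gt0_muley ?lte_fin//= gt0_muley ?lte_fin.
Qed.

(** Under Delta_2 the modular is finite on every multiple of an element of the
    space; this is what makes the norm order continuous. *)
Lemma Delta2_rho_fin f (l l' : R) : Delta2 phi -> L0 f -> (0 < l)%R ->
  (0 < l')%R -> rho phi (fun t => f t / l)%R < +oo ->
  rho phi (fun t => f t / l')%R < +oo.
Proof.
move=> [K K0 hK] mf l0 l'0 fl.
have pow n : rho phi (fun t => 2 ^+ n * (f t / l))%R < +oo.
  elim: n => [|n IH].
    by under eq_fun do rewrite expr0 mul1r.
  under eq_fun do rewrite exprS -mulrA.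
  apply: le_lt_trans (rho_double _ K0 hK) _.
    by apply: L0_mull; exact: L0_scale.
  by rewrite lte_mul_pinfty// lee_fin ltW.
have [n hn] : exists n, (l / l' <= 2 ^+ n)%R.
  exists (Num.bound (l / l')); rewrite (le_trans (ltW (archi_boundP _)))//.
    by rewrite divr_ge0// ltW.
  by rewrite -natrX ler_nat ltnW// ltn_expl.
apply: le_lt_trans (pow n); apply: le_rho => //; first exact: L0_scale.
  by apply: L0_mull; exact: L0_scale.
move=> t _; rewrite !normrM !normfV (gtr0_norm l0) (gtr0_norm l'0).
rewrite (gtr0_norm (exprn_gt0 _ _))// mulrCA ler_wpM2l//.
by rewrite ler_pdivlMr// mulrC.
Qed.

End scaling.

Section no_copy.
Context {R : realType} (phi : R -> \bar R) (hphi : orlicz_function phi).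

Lemma linfty_le (x : nat -> R) (M : R) : (forall n, `|x n| <= M)%R -> linfty x.
Proof.
move=> xM; exists M; split; first exact: num_real.
by move=> y My n _; exact: le_trans (xM n) (ltW My).
Qed.

Lemma linfty_has_sup (x : nat -> R) : linfty x ->
  has_sup (range (fun n => `|x n|%R)).
Proof.
move=> [M [_ xM]]; split; first by exists `|x 0%N|%R, 0%N.
exists (M + 1)%R => _ [n _ <-]; apply: xM => //.
by rewrite ltrDl.
Qed.

Lemma le_linfty_norm (x : nat -> R) n : linfty x -> (`|x n| <= linfty_norm x)%R.
Proof. by move=> /linfty_has_sup/sup_upper_bound; apply; exists n. Qed.

Lemma Ces_norm_le (f : lebR R -> R) (l : R) : (0 < l)%R ->
  rho phi (fun t => f t / l)%R <= 1 -> (Ces_norm phi f <= l)%R.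
Proof.
move=> l0 fl; apply: ge_inf; last by split.
by exists 0%R => y [/ltW].
Qed.

(** The images of the unit vectors e_n are nonnegative, dominated in sum by the
    image of the constant sequence 1, and have norms bounded below by c. Hence
    rho (T e_n / l) >= 1 for l = c / 2 and all n, and superadditivity gives
    N <= rho (T 1 / l) for every N, against the finiteness of the right-hand
    side. *)
Lemma Delta2_no_linfty : Delta2 phi -> ~ contains_linfty phi.
Proof.
move=> D2 [T embT]; have [c [c' [c0 _ hc]]] := embed_iso embT.
have l0 : (0 < c / 2)%R by lra.
set l := (c / 2)%R in l0.
have mT x : linfty x -> L0 (fun t => T x t / l)%R.
  by move=> /(embed_Ces embT)[+ _]; exact: L0_scale.
have superadd x y : linfty x -> linfty y -> (forall n, 0 <= x n)%R ->
    (forall n, 0 <= y n)%R ->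
    rho phi (fun t => T x t / l)%R + rho phi (fun t => T y t / l)%R <=
    rho phi (fun t => T (fun n => 1 * x n + y n)%R t / l)%R.
  move=> bx by_ x0 y0; apply: rho_superadd => //; [exact: mT..| |].
    apply: mT; have [M [_ hM]] := bx; have [N [_ hN]] := by_.
    apply: (@linfty_le _ ((M + 1) + (N + 1))%R) => n.
    rewrite mul1r (le_trans (ler_normD _ _))//.
    by rewrite lerD ?hM ?hN// ltrDl.
  have Tx0 := (embed_order embT bx).1 x0; have Ty0 := (embed_order embT by_).1 y0.
  apply: filterS3 Tx0 Ty0 (embed_linear embT 1%R bx by_) => t xt yt xyt th.
  rewrite !normrM !normfV (gtr0_norm l0) -mulrDl ler_wpM2r ?invr_ge0 ?(ltW l0)//.
  by rewrite xyt// mul1r !ger0_norm ?addr_ge0 ?xt ?yt.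
pose e (n m : nat) : R := (m == n)%:R; pose s (N m : nat) : R := (m < N)%N%:R.
have b_le1 (b : nat -> bool) : linfty (fun m => (b m)%:R : R)%R.
  by apply: (@linfty_le _ 1%R) => m; rewrite ger0_norm// lern1 leq_b1.
have rho_e n : 1 <= rho phi (fun t => T (e n) t / l)%R.
  rewrite leNgt; apply/negP => /ltW /(Ces_norm_le l0) le_l.
  have /andP[+ _] := hc _ (b_le1 (eq_op ^~ n)).
  have := le_linfty_norm n (b_le1 (eq_op ^~ n)).
  rewrite /= eqxx normr1 => norm1 /le_trans/(_ le_l).
  have := ler_wpM2l (ltW c0) norm1; rewrite mulr1 /l; lra.
have rho_s N : N%:R%:E <= rho phi (fun t => T (s N) t / l)%R.
  elim: N => [|N IH]; first exact: rho_ge0.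
  rewrite -natr1 EFinD addrC; apply: le_trans (leeD (rho_e N) IH) _.
  have -> : s N.+1 = (fun n => 1 * e N n + s N n)%R.
    apply/funext => m; rewrite /s /e mul1r ltnS leq_eqVlt.
    by case: ltngtP => _; rewrite ?addr0 ?add0r.
  by apply: superadd => [||n|n]; rewrite ?ler0n//; exact: b_le1.
have rho_s1 N : N%:R%:E <= rho phi (fun t => T (fun=> 1%R) t / l)%R.
  apply: le_trans (rho_s N) _.
  have -> : (fun=> 1%R) = (fun n => 1 * s N n + (~~ (n < N)%N)%:R :> R)%R.
    by apply/funext => m; rewrite /s mul1r; case: ltnP; rewrite ?addr0 ?add0r.
  apply: le_trans (superadd _ _ _ _ _ _); first by rewrite leeDl ?rho_ge0.
  - exact: (b_le1 (fun m => m < N)%N).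
  - exact: (b_le1 (fun m => ~~ (m < N)%N)).
  - by move=> n; rewrite ler0n.
  - by move=> n; rewrite ler0n.
have one_bdd : linfty (fun=> 1%R : R) by apply: (@linfty_le _ 1%R) => m; rewrite normr1.
have [mT1 [l1 l10 T1l1]] := embed_Ces embT one_bdd.
have := Delta2_rho_fin hphi D2 mT1 l10 l0 T1l1.
have := rho_ge0 hphi (fun t => T (fun=> 1%R) t / l)%R.
case: (rho _ _) rho_s1 => // r rho_s1 r0 _.
have := rho_s1 (Num.bound r); rewrite lee_fin leNgt => /negP; apply.
by rewrite archi_boundP.
Qed.

End no_copy.

(** * Functions constant on disjoint intervals *)

Lemma integral_cst_itv (R : realType) (c : \bar R) (i : interval R) :
  \int[leb R]_(t in [set` i]) cst c t = c * lebesgue_measure ([set` i] : set R).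
Proof. by rewrite integral_cst; [|exact: leb_measurable_itv]. Qed.

Section lower_bound.
Context {R : realType} (phi : R -> \bar R) (hphi : orlicz_function phi).

(** On the right half [q/2, q] the Cesaro mean of c 1_]p,q] is
    c (1 - p/x) >= c (1 - 2p/q): when p is much smaller than q, the averaging
    loses almost nothing. *)
Lemma rho_ge_itv (f : lebR R -> R) (p q c : R) : L0 f ->
  (0 <= p)%R -> (0 < q)%R -> (2 * p <= q)%R -> (0 <= c)%R ->
  (forall t : R, p < t <= q -> c <= `|f t|)%R ->
  (q / 2)%:E * phi (c * (1 - 2 * p / q))%R <= rho phi f.
Proof.
move=> mf p0 q0 pq c0 cf; set d := (c * (1 - 2 * p / q))%R.
have d0 : (0 <= d)%R by rewrite mulr_ge0// subr_ge0 ler_pdivrMr// mul1r.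
have half0 : (0 <= q / 2)%R by rewrite divr_ge0// ltW.
have cesaro_ge (x : R) : (q / 2 <= x <= q)%R ->
    d%:E <= cesaro_op (fun t => `|f t|)%R x.
  move=> /andP[qx xq]; have x0 : (0 < x)%R by rewrite (lt_le_trans _ qx)// divr_gt0.
  have px : (p <= x)%R by rewrite (le_trans _ qx)// ler_pdivlMr// mulrC.
  apply: (@le_trans _ _ (x^-1%:E * (c * (x - p))%:E)).
    rewrite -EFinM lee_fin mulrCA ler_wpM2l// mulrBr mulVf ?gt_eqF//.
    rewrite lerB// [leLHS]mulrC ler_pdivrMr// mulrAC ler_pdivlMr//; nra.
  rewrite lee_wpmul2l ?lee_fin ?invr_ge0 ?(ltW x0)//.
  apply: (@le_trans _ _ (\int[leb R]_(t in `]p, x]%classic) (`|f t|)%:E)); last first.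
    apply: ge0_subset_integral.
    - exact: leb_measurable_itv.
    - exact: leb_measurable_itv.
    - exact: measurable_abs_itv.
    - by move=> t _; rewrite lee_fin.
    - by move=> t /=; rewrite !in_itv/= => /andP[pt ->]; rewrite (le_trans p0)// ltW.
  apply: (@le_trans _ _ (\int[leb R]_(t in `]p, x]%classic) (cst c%:E t))).
    rewrite integral_cst_itv lebesgue_measure_itv/= lte_fin.
    case: ifPn => [_|]; first by rewrite -EFinB -EFinM.
    rewrite -leNgt => xp; rewrite mule0 lee_fin.
    by rewrite (_ : x = p) ?subrr ?mulr0//; apply: le_anti; rewrite px xp.
  apply: ge0_le_integral.
  - exact: leb_measurable_itv.
  - by move=> t _; rewrite lee_fin.
  - exact: measurable_cst.
  - apply: (@measurable_funS _ _ _ _ (halfline R)).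
    + exact: measurable_halfline.
    + exact: sub_halfline.
    + exact: L0_abs.
  - move=> t /=; rewrite in_itv/= => /andP[pt tx]; rewrite lee_fin cf// pt.
    exact: le_trans xq.
rewrite rhoE.
pose G x := orlicz_ext phi (cesaro_op (fun t => `|f t|)%R x).
have sub : `[(q / 2)%R, q]%classic `<=` halfline R by exact: sub_halfline.
apply: (@le_trans _ _ (\int[leb R]_(x in `[(q / 2)%R, q]%classic) G x)); last first.
  apply: ge0_subset_integral; last exact: sub.
  - exact: leb_measurable_itv.
  - exact: measurable_halfline.
  - exact: (measurable_orlicz_cesaro hphi).
  - by move=> x xh; apply: (orlicz_cesaro_ge0 hphi).
apply: (@le_trans _ _ (\int[leb R]_(x in `[(q / 2)%R, q]%classic) (cst (phi d) x))).
  rewrite integral_cst_itv lebesgue_measure_itv/= lte_fin ifT; last by lra.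
  by rewrite -EFinB muleC (_ : q - q / 2 = q / 2)%R//; lra.
apply: ge0_le_integral.
- exact: leb_measurable_itv.
- by move=> x _; apply: (orlicz_ge0 hphi).
- exact: measurable_cst.
- apply: (@measurable_funS _ _ _ _ (halfline R)).
  + exact: measurable_halfline.
  + exact: sub.
  + exact: (measurable_orlicz_cesaro hphi).
- move=> x /=; rewrite in_itv/= => /cesaro_ge dx.
  by have := le_orlicz_ext hphi _ dx; apply; rewrite lee_fin.
Qed.

End lower_bound.

Section blocks.
Context {R : realType}.
Implicit Types (p q a u : nat -> R).

Definition disjoint_blocks p q : Prop :=
  [/\ forall k, (0 <= p k < q k)%R &
      forall i j (t : R), (p i < t <= q i)%R -> (p j < t <= q j)%R -> i = j].

(** The function sum_k a_k 1_]p_k,q_k]. Choosing the index of the block that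
    contains t, rather than summing a series, makes linearity and order in the
    coefficients pointwise identities. *)
Definition block p q a : lebR R -> R := fun t =>
  if pselect (exists k, (p k < (t : R) <= q k)%R) is left e
  then a (projT1 (cid e)) else 0%R.

Lemma block_in p q a k (t : R) : disjoint_blocks p q ->
  (p k < t <= q k)%R -> block p q a t = a k.
Proof.
move=> [_ disj] tk; rewrite /block; case: pselect => [e|]; last by case; exists k.
by case: cid => j /= tj; rewrite (disj _ _ _ tj tk).
Qed.

Lemma block_out p q a (t : R) :
  ~ (exists k, p k < t <= q k)%R -> block p q a t = 0%R.
Proof. by rewrite /block; case: pselect. Qed.

Lemma L0_block p q a : disjoint_blocks p q -> L0 (block p q a).
Proof.
rewrite /L0 /mkset => pq _ B mB.
pose E k : set (lebR R) := `]p k, q k]%classic.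
have mE k : measurable (E k) by exact: leb_measurable_itv.
have sE k : E k `<=` halfline R by apply: sub_halfline; case: pq => /(_ k)/andP[].
rewrite (_ : _ `&` _ = \bigcup_(k in [set k | B (a k)]) E k `|`
  (if pselect (B 0%R) then halfline R `\` \bigcup_k E k else set0)).
  apply: measurableU; first by apply: bigcup_measurable => k _; exact: mE.
  case: (pselect (B 0%R)) => B0; last exact: measurable0.
  apply: measurableD; first exact: measurable_halfline.
  by apply: bigcupT_measurable => k; exact: mE.
apply/seteqP; split=> [t [th Bt]|t [[k Bk Ekt]|]].
- have [[k tk]|nt] := pselect (exists k, (p k < (t : R) <= q k)%R).
    left; exists k; last by rewrite /E/= in_itv.
    by move: Bt; rewrite /= (block_in _ pq tk).
  right; move: Bt; rewrite /preimage/= (block_out _ nt) => B0.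
  case: (pselect (B 0%R)) => // B0'; split => // -[k _].
  by rewrite /E/= in_itv/= => tk; apply: nt; exists k.
- split; first exact: sE Ekt.
  by move: Ekt; rewrite /E/= in_itv/= => tk; rewrite /preimage/= (block_in _ pq tk).
case: (pselect (B 0%R)) => // B0 [th nt]; split => //; rewrite /preimage/= block_out//.
by move=> [k tk]; apply: nt; exists k => //; rewrite /E/= in_itv.
Qed.

Lemma ae_itv_witness (P : lebR R -> Prop) (p q : R) : (p < q)%R ->
  {ae leb R, forall t, P t} -> exists2 t : R, (p < t <= q)%R & P t.
Proof.
move=> pq [A [mA A0 PA]]; apply: contrapT => nP.
have : leb R `]p, q]%classic <= leb R A.
  apply: le_measure; rewrite ?inE//; first exact: leb_measurable_itv.
  move=> t /=; rewrite in_itv/= => tpq; apply: PA => Pt.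
  by apply: nP; exists t.
by rewrite A0 leb_itv lebesgue_measure_itv/= lte_fin pq -EFinB lee_fin leNgt subr_gt0 pq.
Qed.

End blocks.

(** * Copies of l^oo spanned by blocks *)

Section copy.
Context {R : realType} (phi : R -> \bar R) (hphi : orlicz_function phi).

(** The 2-adic valuation distributes the indices of the blocks into infinitely
    many infinite classes, one for each coordinate of l^oo. *)
Lemma logn2_infinite (n N : nat) : exists2 k, (N <= k)%N & logn 2 k = n.
Proof.
exists (2 ^ n * (N.*2).+1)%N.
  rewrite (leq_trans _ (leq_pmull _ _)) ?expn_gt0//.
  by rewrite -addnn leqW// leq_addr.
rewrite lognM ?expn_gt0// pfactorK// logn_coprime ?addn0//.
by rewrite coprime2n /= odd_double.
Qed.

(** Send x to sum_k x_(v k) u_k 1_]p_k,q_k] with v the 2-adic valuation. Its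
    modulus is at most |x|_oo times the block function F of u, so its norm is at
    most |x|_oo. Conversely, if l < |x_n|, then dividing by l leaves at least
    r u_k with r > 1 on each of the infinitely many blocks of class n, and a
    block of large index then has modular above 1 by itself: the norm is at
    least |x_n|. *)
Lemma blocks_linfty (p q u : nat -> R) : disjoint_blocks p q ->
  (forall k, 0 < u k)%R -> rho phi (block p q u) <= 1 ->
  (forall r : R, (1 < r)%R -> exists N, forall k (f : lebR R -> R), (N <= k)%N ->
    L0 f -> (forall t : R, p k < t <= q k -> r * u k <= `|f t|)%R ->
    1 < rho phi f) ->
  contains_linfty_isometrically phi.
Proof.
move=> pq u0 rho1 esc.
pose T (x : nat -> R) := block p q (fun k => x (logn 2 k) * u k)%R.
have mT x l : L0 (fun t => T x t / l)%R by apply: L0_scale; exact: L0_block.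
have Tle x l : linfty x -> (0 < l)%R -> (linfty_norm x <= l)%R ->
    rho phi (fun t => T x t / l)%R <= 1.
  move=> bx l0 xl; apply: le_trans rho1; apply: le_rho => //; first exact: L0_block.
  move=> t _; have [[k tk]|nt] := pselect (exists k, (p k < (t : R) <= q k)%R).
    rewrite /T !(block_in _ pq tk) !normrM normfV mulrAC (gtr0_norm l0) (gtr0_norm (u0 k)).
    rewrite ler_piMl ?(ltW (u0 k))// ler_pdivrMr// mul1r.
    exact: le_trans (le_linfty_norm _ bx) xl.
  by rewrite /T !(block_out _ nt) mul0r normr0.
have Tgt x l n : linfty x -> (0 < l)%R -> (l < `|x n|)%R ->
    1 < rho phi (fun t => T x t / l)%R.
  move=> bx l0 lx; have [|N hN] := esc (`|x n| / l)%R; first by rewrite ltr_pdivlMr// mul1r.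
  have [k Nk kn] := logn2_infinite n N.
  apply: (hN k) => // t tk.
  by rewrite /T (block_in _ pq tk) kn !normrM normfV (gtr0_norm l0) (gtr0_norm (u0 k)) mulrAC.
have norm0 x : linfty x -> (0 <= linfty_norm x)%R.
  by move=> /(le_linfty_norm 0%N); exact: le_trans.
have Tnorm x : linfty x -> Ces_norm phi (T x) = linfty_norm x.
  move=> bx; apply: le_anti; apply/andP; split.
    apply/ler_addgt0Pr => e e0; apply: Ces_norm_le.
      by rewrite ltr_wpDl// norm0.
    by apply: Tle => //; [rewrite ltr_wpDl// norm0|rewrite lerDl ltW].
  apply: lb_le_inf.
    exists (linfty_norm x + 1)%R; split; first by rewrite ltr_wpDl// norm0.
    by apply: Tle => //; [rewrite ltr_wpDl// norm0|rewrite lerDl].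
  move=> l [l0 hl]; apply: sup_le_ub; first by exists `|x 0%N|%R, 0%N.
  move=> _ [n _ <-]; rewrite leNgt; apply/negP => /(Tgt _ _ _ bx l0).
  by rewrite ltNge hl.
exists T => //; split.
- move=> x bx; split; first exact: L0_block.
  exists (linfty_norm x + 1)%R; first by rewrite ltr_wpDl// norm0.
  apply: le_lt_trans (Tle _ _ bx _ _) _; rewrite ?ltry//.
    by rewrite ltr_wpDl// norm0.
  by rewrite lerDl.
- move=> a x y bx by_; apply: aeW => t _.
  have [[k tk]|nt] := pselect (exists k, (p k < (t : R) <= q k)%R).
    by rewrite /T !(block_in _ pq tk) mulrDl mulrA.
  by rewrite /T !(block_out _ nt) mulr0 addr0.
- move=> x bx; split=> [x0|Tx0 n].
    apply: aeW => t _.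
    have [[k tk]|nt] := pselect (exists k, (p k < (t : R) <= q k)%R).
      by rewrite /T (block_in _ pq tk) mulr_ge0// ltW.
    by rewrite /T (block_out _ nt).
  have [k _ kn] := logn2_infinite n 0%N.
  have [pq0 _] := pq; have /andP[pk0 pkq] := pq0 k.
  have [t tk] := ae_itv_witness pkq Tx0.
  rewrite /T (block_in _ pq tk) kn pmulr_lge0//; apply.
  rewrite /halfline/= in_itv/= andbT (le_trans pk0)//.
  by case/andP : tk => /ltW.
- exists 1%R, 1%R; split => // x bx.
  by rewrite mul1r Tnorm// lexx.
Qed.

End copy.

(** * Failure of Delta_2 and lacunary blocks *)

Lemma bernoulli_ineq (R : realFieldType) (l : R) n : (1 <= l)%R -> (1 + n%:R * (l - 1) <= l ^+ n)%R.
Proof.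
move=> l1; elim: n => [|n IH]; first by rewrite mul0r addr0 expr0.
have l0 : (0 <= l)%R by lra.
rewrite exprS; apply: le_trans (ler_wpM2l l0 IH).
rewrite -natr1; have := mulr_ge0 (ler0n R n) (sqr_ge0 (l - 1)%R); lra.
Qed.

Section growth.
Context {R : realType} (phi : R -> \bar R) (hphi : orlicz_function phi).

(** If phi (l u) <= K phi u held for all u with some l > 1, iterating it until
    l^n >= 2 would give Delta_2. *)
Lemma not_Delta2_dilation : ~ Delta2 phi -> forall l K : R, (1 < l)%R -> (0 < K)%R ->
  exists2 u : R, (0 < u)%R & K%:E * phi u < phi (l * u)%R.
Proof.
move=> nD l K l1 K0; apply: contrapT => H; apply: nD.
have l0 : (0 < l)%R by lra.
have step (u : R) : (0 <= u)%R -> phi (l * u)%R <= K%:E * phi u.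
  rewrite le_eqVlt => /predU1P[<-|u0].
    by rewrite mulr0 (orlicz0 hphi) mule0.
  by rewrite leNgt; apply/negP => lu; apply: H; exists u.
have iter_step n (u : R) : (0 <= u)%R -> phi (l ^+ n * u)%R <= (K ^+ n)%:E * phi u.
  move=> u0; elim: n => [|n IH]; first by rewrite !expr0 mul1r mul1e.
  rewrite !exprS -mulrA; apply: le_trans (step _ _) _.
    by rewrite mulr_ge0// exprn_ge0// ltW.
  by rewrite EFinM -muleA lee_wpmul2l// lee_fin ltW.
have [n hn] : exists n, (2 <= l ^+ n)%R.
  exists (Num.bound (l - 1)^-1%R).
  apply: le_trans (bernoulli_ineq _ (ltW l1)).
  have li : (0 < l - 1)%R by lra.
  have : (0 <= (l - 1)^-1)%R by rewrite invr_ge0 ltW.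
  by move=> /archi_boundP; rewrite -{1}div1r ltr_pdivrMr// => ?; lra.
exists (K ^+ n)%R; first exact: exprn_gt0.
move=> u u0; apply: le_trans (iter_step n u u0).
by apply: le_orlicz => //; [rewrite mulr_ge0|rewrite ler_wpM2r].
Qed.

End growth.

Section lacunary.
Context {R : realType}.

Lemma dependent_choice_from (A : Type) (Q : nat -> A -> A -> Prop) (x0 : A) :
  (forall k x, exists y, Q k x y) ->
  exists s : nat -> A, Q 0%N x0 (s 0%N) /\ forall k, Q k.+1 (s k) (s k.+1).
Proof.
move=> H; have [g hg] := choice (fun kx : nat * A => H kx.1 kx.2).
pose s := fix s k := if k is j.+1 then g (k, s j) else g (0%N, x0).
exists s; split; first exact: (hg (0%N, x0)).
by move=> k; exact: (hg (k.+1, s k)).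
Qed.

(** If lengths L satisfying P k can be found arbitrarily small (resp. large) for
    every k, choose them successively so that they decrease (resp. increase)
    very fast: the intervals between consecutive lengths are disjoint, and each
    starts very near 0 relative to its right endpoint. *)
Lemma lacunary_blocks (P : nat -> R -> R -> Prop) :
  (forall k d, (0 < d)%R -> exists L u, (0 < L <= d)%R /\ P k L u) \/
  (forall k M, exists L u, (0 < L)%R /\ (M <= L)%R /\ P k L u) ->
  exists p q u : nat -> R, disjoint_blocks p q /\
    forall k, (2 * k.+2%:R * p k <= q k)%R /\ P k (q k) (u k).
Proof.
have c1 k : (1 <= 2 * k.+2%:R :> R)%R.
  by rewrite -natrM ler1n muln_gt0.
have c0 k : (0 < 2 * k.+2%:R :> R)%R by exact: lt_le_trans (c1 k).
have c2 k : (1 < 2 * k.+2%:R :> R)%R by rewrite -natrM ltr1n !mulnS.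
have blocksP (p q : nat -> R) : (forall k, 0 < q k)%R -> (forall k, 0 <= p k)%R ->
    (forall k, 2 * k.+2%:R * p k <= q k)%R ->
    (forall i j, (i < j)%N -> q j <= p i)%R \/ (forall i j, (i < j)%N -> q i <= p j)%R ->
    disjoint_blocks p q.
  move=> q0 p0 pq sep; split.
    move=> k; rewrite p0/=; have := pq k; have := q0 k; have := p0 k; have := c2 k.
    by set c := (2 * _)%R => ? ? ? ?; nra.
  move=> i j t /andP[pi qi] /andP[pj qj].
  case: sep => sep; case: (ltngtP i j) => // /sep qp; exfalso; move: qp.
  - by apply/negP; rewrite -ltNge (lt_le_trans pi).
  - by apply/negP; rewrite -ltNge (lt_le_trans pj).
  - by apply/negP; rewrite -ltNge (lt_le_trans pj).
  - by apply/negP; rewrite -ltNge (lt_le_trans pi).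
case=> H.
  have {}H k (x : R * R) : exists y : R * R,
      (0 < x.1)%R -> [/\ (0 < y.1)%R, (2 * k.+1%:R * y.1 <= x.1)%R & P k y.1 y.2].
    have [x0|x0] := ltP 0%R x.1; last by exists x; rewrite ltNge x0.
    have [|L [u [/andP[L0 Lx] PL]]] := H k (x.1 / (2 * k.+1%:R))%R.
      by rewrite divr_gt0// mulr_gt0.
    exists (L, u) => _; split => //=.
    by rewrite mulrC -ler_pdivlMr// mulr_gt0.
  have [s [s0 sS]] := dependent_choice_from (1%R, 1%R) H.
  have pos k : (0 < (s k).1)%R.
    by elim: k => [|k IH]; [have [] := s0 ltr01|have [] := sS k IH].
  have le1 k : (2 * k.+2%:R * (s k.+1).1 <= (s k).1)%R by have [] := sS k (pos k).
  (* The k-th block is ]L_(k+1), L_k]. *)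
  exists (fun k => (s k.+1).1), (fun k => (s k).1), (fun k => (s k).2); split.
    apply: blocksP => //; first by move=> k; exact: ltW.
    left; have dec k : ((s k.+1).1 <= (s k).1)%R.
      by apply: le_trans (le1 k); rewrite ler_peMl// ltW.
    move=> i; elim=> // j IH; rewrite ltnS leq_eqVlt => /predU1P[->//|/IH].
    exact: le_trans.
  move=> k; split=> //; case: k => [|k]; first by have [] := s0 ltr01.
  by have [] := sS k (pos k).
have {}H k (x : R * R) : exists y : R * R,
    [/\ (0 < y.1)%R, (2 * k.+2%:R * x.1 <= y.1)%R & P k y.1 y.2].
  by have [L [u [L0 [xL PL]]]] := H k (2 * k.+2%:R * x.1)%R; exists (L, u).
have [s [[s00 _ s0P] sS]] := dependent_choice_from (1%R, 1%R) H.
have pos k : (0 < (s k).1)%R by case: k => // k; have [] := sS k.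
have le1 k : (2 * k.+3%:R * (s k).1 <= (s k.+1).1)%R by have [] := sS k.
(* The k-th block is ]L_(k-1), L_k], with L_(-1) = 0. *)
exists (fun k => if k is j.+1 then (s j).1 else 0%R), (fun k => (s k).1),
  (fun k => (s k).2); split.
  apply: blocksP => //.
  - by case=> [|k] //; exact: ltW.
  - by case=> [|k]; [rewrite mulr0 ltW|exact: le1].
  right; have inc k : ((s k).1 <= (s k.+1).1)%R.
    by apply: le_trans (le1 k); rewrite ler_peMl// ltW.
  move=> i; case=> // j; elim: j => [|j IH].
    by rewrite ltnS leqn0 => /eqP->.
  rewrite ltnS leq_eqVlt => /predU1P[->//|/IH /le_trans]; exact.
move=> [|k]; first by rewrite mulr0 ltW.
by split; [exact: le1|have [] := sS k].
Qed.

End lacunary.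

Section good_blocks.
Context {R : realType} (phi : R -> \bar R) (hphi : orlicz_function phi).

(** Since 2 p_k / q_k <= 1 / (k + 2), averaging reduces the value r u_k on the
    k-th block to at least r (1 - 1 / (k + 2)) u_k. For large k this exceeds
    (1 + 1 / (k + 1)) u_k, at which phi makes the modular at least 3 / 2. *)
Lemma good_blocks_linfty (p q u : nat -> R) : disjoint_blocks p q ->
  (forall k, 2 * k.+2%:R * p k <= q k)%R -> (forall k, 0 < u k)%R ->
  (forall k, 3%:E <= (q k)%:E * phi ((1 + k.+1%:R^-1) * u k)%R) ->
  rho phi (block p q u) <= 1 -> contains_linfty_isometrically phi.
Proof.
move=> pq pq2 u0 big rho1; apply: (blocks_linfty hphi pq u0 rho1) => r r1.
exists (Num.bound (3 / (r - 1))%R) => k f Nk mf rf.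
have [/(_ k) /andP[pk0 pkq] _] := pq.
have qk0 : (0 < q k)%R by exact: le_lt_trans pkq.
set n : R := k.+1%:R.
have n1 : (1 <= n)%R by rewrite ler1n.
have En : k.+2%:R = (n + 1)%R by rewrite /n natr1.
have hn : (3 <= n * (r - 1))%R.
  rewrite -ler_pdivrMr; last by lra.
  rewrite (le_trans (ltW (archi_boundP _)))//; first by rewrite divr_ge0//; lra.
  by rewrite ler_nat leqW.
have h2 : (2 * p k / q k <= (n + 1)^-1)%R.
  rewrite ler_pdivrMr// [leRHS]mulrC ler_pdivlMr; last by lra.
  by rewrite -En mulrAC.
have n10 : (0 < n + 1)%R by lra.
have n0 : (0 < n)%R by lra.
have pq1 : (2 * p k <= q k)%R.
  by apply: le_trans (pq2 k); rewrite En; nra.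
apply: lt_le_trans (rho_ge_itv hphi mf pk0 qk0 pq1 _ rf); last first.
  by rewrite mulr_ge0 ?(ltW (u0 k))//; lra.
apply: (@lt_le_trans _ _ ((2^-1)%:E * (3%:E))).
  by rewrite -EFinM lte_fin; lra.
apply: (@le_trans _ _ ((q k / 2)%:E * phi ((1 + n^-1) * u k)%R)).
  by rewrite mulrC EFinM -muleA lee_wpmul2l ?big// lee_fin.
rewrite lee_wpmul2l//; first by rewrite lee_fin divr_ge0// ltW.
have ni0 : (0 < n^-1)%R by rewrite invr_gt0.
apply: (le_orlicz hphi).
  by rewrite mulr_ge0 ?(ltW (u0 k))// addr_ge0// ltW.
rewrite mulrAC ler_wpM2r ?(ltW (u0 k))//.
apply: (@le_trans _ _ (r * (1 - (n + 1)^-1))%R); last first.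
  by apply: ler_wpM2l; [lra|rewrite lerB].
have -> : (1 + n^-1 = (n + 1) / n)%R by rewrite mulrDl divff ?gt_eqF// mul1r.
have -> : (1 - (n + 1)^-1 = n / (n + 1))%R.
  by field; rewrite gt_eqF.
rewrite mulrA ler_pdivlMr// mulrAC ler_pdivrMr//; nra.
Qed.

(** A point u where phi ((1 + 1/(k+1)) u) is huge compared with phi u admits a
    length L for which L phi u is small and L phi ((1 + 1/(k+1)) u) is large.
    Such lengths exist either arbitrarily small for every k or arbitrarily large
    for every k. Otherwise, for some k, they would all lie in a fixed compact
    subinterval of ]0, +oo[, but the larger the ratio of the two values of phi,
    the wider the range of the lengths that suit u. *)
Lemma not_Delta2_blocks (d : R) : ~ Delta2 phi -> (0 < d)%R ->
  exists p q u : nat -> R, [/\ disjoint_blocks p q,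
    (forall k, 2 * k.+2%:R * p k <= q k)%R, (forall k, 0 < u k)%R,
    (forall k, (q k)%:E * phi (u k) <= (d / (2 ^ k.+1)%:R)%:E) &
    (forall k, 3%:E <= (q k)%:E * phi ((1 + k.+1%:R^-1) * u k)%R)].
Proof.
move=> nD d0.
pose good k L u := [/\ (0 < u)%R, L%:E * phi u <= (d / (2 ^ k.+1)%:R)%:E &
  3%:E <= L%:E * phi ((1 + k.+1%:R^-1) * u)%R].
suff /lacunary_blocks [p [q [u [pq H]]]] :
  (forall k d, (0 < d)%R -> exists L u, (0 < L <= d)%R /\ good k L u) \/
  (forall k M, exists L u, (0 < L)%R /\ (M <= L)%R /\ good k L u).
  by exists p, q, u; split => // k; have [? []] := H k.
apply: contrapT => /not_orP[].
move=> /existsNP[k0 /existsNP[d1 /not_implyP[d10 small]]].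
move=> /existsNP[k1 /existsNP[M0 large]].
pose M := (Num.max M0 1)%R.
have M1 : (0 < M)%R by rewrite lt_max ltr01 orbT.
pose k := maxn k0 k1.
have goodW j L u : (j <= k)%N -> (0 < L)%R -> good k L u -> good j L u.
  move=> jk L0 [u0 h1 h2]; split => //.
    apply: (le_trans h1); rewrite lee_fin ler_wpM2l ?(ltW d0)//.
    by rewrite lef_pV2 ?posrE ?ltr0n ?expn_gt0// ler_nat leq_exp2l.
  apply: (le_trans h2); rewrite lee_wpmul2l ?lee_fin ?(ltW L0)//.
  apply: (le_orlicz hphi); first by rewrite mulr_ge0 ?addr_ge0 ?(ltW u0).
  by rewrite ler_wpM2r ?(ltW u0)// lerD2l lef_pV2 ?posrE ?ltr0n// ler_nat.
set e := (d / (2 ^ k.+1)%:R)%R.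
have e0 : (0 < e)%R by rewrite divr_gt0// ltr0n expn_gt0.
(* With v just above K phi u, the first term keeps (3 / v) phi u below e, and
   the second one keeps M phi u below e when 3 / v exceeds d1. *)
pose K := (3 / e + 3 * M / (d1 * e))%R.
have K1 : (0 < 3 / e)%R by rewrite divr_gt0.
have K2 : (0 < 3 * M / (d1 * e))%R by rewrite divr_gt0// mulr_gt0.
have K0 : (0 < K)%R by rewrite addr_gt0.
have l1 : (1 < 1 + k.+1%:R^-1 :> R)%R by rewrite ltrDl.
have [u u0 hu] := not_Delta2_dilation hphi nD l1 K0.
have [x Ex] : exists x, phi u = x%:E.
  have := orlicz_ge0 hphi (ltW u0); move: hu; case: (phi u) => [x| |]//; first by exists x.
  by rewrite gt0_muley ?lte_fin// ltNge leey.
have x0 : (0 <= x)%R by have := orlicz_ge0 hphi (ltW u0); rewrite Ex lee_fin.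
have [v Kv vl] : exists2 v : R, (K * x < v)%R & v%:E <= phi ((1 + k.+1%:R^-1) * u)%R.
  move: hu; rewrite Ex -EFinM; case: (phi _) => [y|_|]//.
    by rewrite lte_fin => xy; exists y.
  by exists (K * x + 1)%R; [rewrite ltrDl|rewrite leey].
have v0 : (0 < v)%R by apply: le_lt_trans Kv; rewrite mulr_ge0// ltW.
have big L : (3 / v <= L)%R -> 3%:E <= L%:E * phi ((1 + k.+1%:R^-1) * u)%R.
  move=> vL; have L0 : (0 <= L)%R by apply: le_trans vL; rewrite divr_ge0// ltW.
  apply: (@le_trans _ _ (L%:E * v%:E)); last by rewrite lee_wpmul2l.
  by rewrite -EFinM lee_fin -ler_pdivrMr.
have xv : (3 / v * x <= e)%R.
  have : (3 / e * x <= v)%R.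
    by apply: le_trans (ltW Kv); rewrite ler_wpM2r// lerDl ltW.
  by rewrite mulrAC ler_pdivrMr// => h; rewrite mulrAC ler_pdivrMr// [leRHS]mulrC.
have [vd|vd] := leP (3 / v)%R d1.
  apply: small; exists (3 / v)%R, u; split; first by rewrite divr_gt0.
  apply: (goodW); rewrite ?leq_maxl ?divr_gt0//; split => //; last exact: big.
  by rewrite Ex -EFinM lee_fin.
have xM : (M * x <= e)%R.
  have vd1 : (v * d1 < 3)%R by move: vd; rewrite ltr_pdivlMr// mulrC.
  have : (3 * M / (d1 * e) * x <= v)%R.
    by apply: le_trans (ltW Kv); rewrite ler_wpM2r// lerDr ltW.
  rewrite mulrAC ler_pdivrMr ?mulr_gt0// mulrA => h.
  have : (3 * M * x <= 3 * e)%R by apply: le_trans h _; rewrite ler_wpM2r// ltW.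
  by rewrite -mulrA ler_pM2l.
apply: large; exists (Num.max M (3 / v))%R, u.
have L0 : (0 < Num.max M (3 / v))%R by rewrite lt_max M1.
split => //; split; first by rewrite le_max /M le_max lexx.
apply: goodW; rewrite ?leq_maxr//; split => //; last by apply: big; rewrite le_max lexx orbT.
rewrite Ex -EFinM lee_fin; case: (leP M (3 / v)%R) => // _.
Qed.

End good_blocks.

(** * The case phi(b) = +oo *)

Section infinite_case.
Context {R : realType} (phi : R -> \bar R) (hphi : orlicz_function phi).

Lemma orlicz_modular_block (p q u : nat -> R) (d : R) : disjoint_blocks p q ->
  (0 <= d)%R -> (forall k, 0 < u k)%R ->
  (forall k, (q k)%:E * phi (u k) <= (d / (2 ^ k.+1)%:R)%:E) ->
  orlicz_modular phi (fun t => (block p q u t)%:E) <= d%:E.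
Proof.
move=> pq d0 u0 small.
have [pq0 _] := pq.
have q0 k : (0 < q k)%R by have /andP[p0 pqk] := pq0 k; exact: le_lt_trans pqk.
have phi0 k : 0 <= phi (u k) by apply: (orlicz_ge0 hphi); exact: ltW.
pose w k := fine (phi (u k)).
have wE k : phi (u k) = (w k)%:E.
  rewrite /w fineK// ge0_fin_numE// ltey; apply/eqP => phioo.
  by have := small k; rewrite phioo gt0_muley ?lte_fin.
have w0 k : (0 <= w k)%R by rewrite -lee_fin -wE.
pose f (t : lebR R) := (block p q w t)%:E.
have f0 t : 0 <= f t.
  rewrite /f lee_fin; have [[k tk]|nt] := pselect (exists k, (p k < (t : R) <= q k)%R).
    by rewrite (block_in _ pq tk).
  by rewrite (block_out _ nt).
have -> : orlicz_modular phi (fun t => (block p q u t)%:E) =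
    \int[leb R]_(t in halfline R) f t.
  apply: eq_integral => t _; rewrite /f.
  have [[k tk]|nt] := pselect (exists k, (p k < (t : R) <= q k)%R).
    by rewrite !(block_in _ pq tk) /= ger0_norm ?wE// ltW.
  by rewrite !(block_out _ nt) /= normr0 (orlicz0 hphi).
pose E k : set (lebR R) := `]p k, q k]%classic.
have mE k : measurable (E k) by exact: leb_measurable_itv.
pose U := \bigcup_k E k.
have mU : measurable U by apply: bigcupT_measurable => k; exact: mE.
have UH : U `<=` halfline R.
  by move=> t [k _]; apply: sub_halfline; have /andP[] := pq0 k.
have mf : measurable_fun (halfline R) f.
  by apply/measurable_EFinP; exact: L0_block.
have -> : \int[leb R]_(t in halfline R) f t = \int[leb R]_(t in U) f t.
  rewrite [LHS]integral_mkcond [RHS]integral_mkcond; apply: eq_integral => t _.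
  rewrite /patch; have [tU|tU] := boolP (t \in U).
    by rewrite ifT// inE; apply: UH; rewrite inE in tU.
  case: ifP => // _; rewrite /f block_out// => -[k tk].
  by move/negP: tU; apply; rewrite inE; exists k => //; rewrite /E/= in_itv.
have -> : \int[leb R]_(t in U) f t = \sum_(0 <= k <oo) \int[leb R]_(t in E k) f t.
  apply: ge0_integral_bigcup.
  - exact: mE.
  - by apply: (@measurable_funS _ _ _ _ (halfline R)); [exact: measurable_halfline| |].
  - by move=> t _; exact: f0.
  - apply/trivIsetP => i j _ _ ij; apply/seteqP; split => // t [].
    rewrite /E/= !in_itv/= => ti tj; case/eqP: ij.
    by case: pq => _; apply; [exact: ti|exact: tj].
apply: le_trans (epsilon_trick0 xpredT d0).
apply: lee_nneseries => [k _ _|k _]; first by apply: integral_ge0 => t _; exact: f0.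
apply: le_trans (small k).
have -> : \int[leb R]_(t in E k) f t = \int[leb R]_(t in E k) cst (w k)%:E t.
  apply: eq_integral => t; rewrite inE /E/= in_itv/= => tk.
  by rewrite /f (block_in _ pq tk).
rewrite integral_cst_itv lebesgue_measure_itv/= lte_fin.
have /andP[pk pqk] := pq0 k.
by rewrite pqk -EFinB -EFinM wE -EFinM lee_fin mulrC ler_wpM2r// gerBl.
Qed.

(** The bound of rho by I_phi applies to the block function wherever the blocks
    lie, so it suffices to make I_phi at most 1 / D. *)
Lemma rho_le_modular_linfty (D : R) : (0 < D)%R ->
  (forall f : lebR R -> R, orlicz_class phi f ->
     rho phi f <= D%:E * orlicz_modular phi (fun t => (f t)%:E)) ->
  ~ Delta2 phi -> contains_linfty_isometrically phi.
Proof.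
move=> D0 hD nD2; have Di0 : (0 < D^-1)%R by rewrite invr_gt0.
have [p [q [u [pq pq2 u0 small big]]]] := not_Delta2_blocks hphi nD2 Di0.
have modF := orlicz_modular_block pq (ltW Di0) u0 small.
apply: (good_blocks_linfty hphi pq pq2 u0 big).
apply: le_trans (hD _ _) _.
  split; first exact: L0_block.
  exact: le_lt_trans modF (ltry _).
apply: (@le_trans _ _ (D%:E * (D^-1)%:E)).
  by rewrite lee_wpmul2l// lee_fin ltW.
by rewrite -EFinM divff// gt_eqF.
Qed.

End infinite_case.

(** * The case phi(b) < +oo *)

Section finite_case.
Context {R : realType} (phi : R -> \bar R) (hphi : orlicz_function phi).

Definition bump (c h : R) : lebR R -> \bar R :=
  fun x => (c * \1_(`[0%R, h]%classic : set R) x)%:E.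

Lemma measurable_bump c h : measurable_fun (halfline R) (bump c h).
Proof.
apply/measurable_EFinP; apply: measurable_funM => //.
have m1 : measurable_fun (setT : set (lebR R)) (\1_(`[0%R, h]%classic) : lebR R -> R).
  by apply: measurable_indic; exact: leb_measurable_itv.
apply: (@measurable_funS _ _ _ _ setT) m1; [exact: measurableT|exact: subsetT].
Qed.

Lemma bump_ge0 c h x : (0 <= c)%R -> 0 <= bump c h x.
Proof. by move=> c0; rewrite lee_fin mulr_ge0. Qed.

Lemma bumpE c h (x : R) : (0 <= x <= h)%R -> bump c h x = c%:E.
Proof.
by move=> xh; rewrite /bump indicE mem_set ?mulr1//= in_itv.
Qed.

Lemma integral_bump c h : (0 <= c)%R -> (0 <= h)%R ->
  \int[leb R]_(x in halfline R) bump c h x = (c * h)%:E.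
Proof.
move=> c0 h0.
have -> : \int[leb R]_(x in halfline R) bump c h x =
    \int[leb R]_(x in `[0%R, h]%classic) cst c%:E x.
  rewrite [LHS]integral_mkcond [RHS]integral_mkcond; apply: eq_integral => t _.
  rewrite /patch /bump indicE.
  have [tU|tU] := boolP (t \in (`[0%R, h]%classic : set (lebR R))).
    rewrite ifT ?mulr1// inE; have := tU; rewrite inE; exact: sub_halfline.
  by rewrite mulr0; case: ifP.
rewrite integral_cst_itv lebesgue_measure_itv/= lte_fin.
case: ifPn => [_|]; first by rewrite oppr0 adde0.
by rewrite -leNgt => h1; rewrite (_ : h = 0%R) ?mulr0 ?mule0//; apply: le_anti; rewrite h0 h1.
Qed.

Lemma primitive_bound (f : lebR R -> R) (b h x : R) : L0 f -> (0 <= b)%R ->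
  (0 <= h)%R -> (forall t, halfline R t -> `|f t| <= b)%R ->
  (forall t : R, h < t -> f t = 0)%R ->
  \int[leb R]_(t in `[0%R, x]%classic) (`|f t|)%:E <= (b * h)%:E.
Proof.
move=> mf b0 h0 fb fh; rewrite -integral_bump//.
apply: (@le_trans _ _ (\int[leb R]_(t in halfline R) (`|f t|)%:E)).
  apply: ge0_subset_integral.
  - exact: leb_measurable_itv.
  - exact: measurable_halfline.
  - exact: L0_abs.
  - by move=> t _; rewrite lee_fin.
  - exact: sub_halfline.
apply: ge0_le_integral.
- exact: measurable_halfline.
- by move=> t _; rewrite lee_fin.
- exact: L0_abs.
- exact: measurable_bump.
move=> t th; have [tle|tgt] := leP (t : R) h; last first.
  by rewrite fh// normr0 bump_ge0.
rewrite bumpE ?lee_fin ?fb// tle andbT.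
by move: th; rewrite /halfline/= in_itv/= andbT.
Qed.

Lemma primitive_bound_cst (f : lebR R -> R) (b x : R) : L0 f -> (0 <= b)%R ->
  (0 <= x)%R -> (forall t, halfline R t -> `|f t| <= b)%R ->
  \int[leb R]_(t in `[0%R, x]%classic) (`|f t|)%:E <= (b * x)%:E.
Proof.
move=> mf b0 x0 fb.
apply: (@le_trans _ _ (\int[leb R]_(t in `[0%R, x]%classic) cst b%:E t)).
  apply: ge0_le_integral.
  - exact: leb_measurable_itv.
  - by move=> t _; rewrite lee_fin.
  - exact: measurable_abs_itv.
  - exact: measurable_cst.
  - by move=> t tx; rewrite lee_fin fb//; exact: sub_halfline tx.
rewrite integral_cst_itv lebesgue_measure_itv/= lte_fin.
by case: ifP => _; [rewrite oppr0 adde0|rewrite mule0 lee_fin mulr_ge0].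
Qed.

(** A nonzero element of the space has a positive integral over some [0, x0], so
    that its Cesaro means are at least M / x beyond x0. This bounds the tail of
    the modular of any function of bounded support. *)
Lemma Ces_nontrivial_mass : Ces_nontrivial phi -> exists g : lebR R -> R,
  [/\ L0 g, rho phi g < +oo & exists x0 M : R, [/\ (0 < x0)%R, (0 < M)%R &
    M%:E <= \int[leb R]_(t in `[0%R, x0]%classic) (`|g t|)%:E]].
Proof.
move=> [f [mf [l l0 fl]] fn0]; exists (fun t => f t / l)%R.
have mg : L0 (fun t => f t / l)%R by exact: L0_scale.
split => //; apply: contrapT => H; apply: fn0.
have I0 n : \int[leb R]_(t in `[0%R, n.+1%:R]%classic) (`|f t / l|)%:E = 0.
  apply: le_anti; rewrite integral_ge0 ?andbT; last by move=> t _; rewrite lee_fin.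
  rewrite leNgt; apply/negP => Ipos; apply: H; exists n.+1%:R%R.
  move: Ipos; case: (\int[_]_(_ in _) _) => [r| |]//.
    by rewrite lte_fin => r0; exists r.
  by move=> _; exists 1%R; rewrite leey.
have ae0 n : {ae leb R, forall t, (`[0%R, n.+1%:R]%classic : set (lebR R)) t -> f t = 0%R}.
  have mI : measurable (`[0%R, n.+1%:R]%classic : set (lebR R)) by exact: leb_measurable_itv.
  have mgn : measurable_fun (`[0%R, n.+1%:R]%classic : set (lebR R)) (fun t => (f t / l)%:E).
    apply: (@measurable_funS _ _ _ _ (halfline R)); first exact: measurable_halfline.
      exact: sub_halfline.
    exact/measurable_EFinP.
  have [+ _] := ae_eq_integral_abs (leb R) mI mgn.
  move=> /(_ (I0 n)); apply: filterS => t ft tn.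
  have [ftl] : (f t / l)%:E = 0%R%:E := ft tn.
  have /eqP := ftl; rewrite mulf_eq0 invr_eq0 (gt_eqF l0) orbF.
  by move/eqP.
apply: filterS (ae_foralln ae0) => t ft th.
apply: (ft (Num.bound (t : R))); rewrite /= in_itv/=.
move: th; rewrite /halfline/= in_itv/= andbT => t0; rewrite t0/=.
by rewrite (le_trans (ltW (archi_boundP t0)))// ler_nat.
Qed.


(** Let |f| <= b vanish beyond d. Its Cesaro mean is at most b and at most
    b d / x. The first bound is used on [0, h] with h small, the second one on
    [h, x0], where phi (b d / h) <= (d / h) phi b, and beyond x0, where b d / x
    is a small multiple of the Cesaro mean of an element of finite modular. *)
Lemma small_support_rho (b : R) : Ces_nontrivial phi -> (0 < b)%R ->
  phi b < +oo -> exists2 d : R, (0 < d)%R & forall f : lebR R -> R, L0 f ->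
    (forall t, halfline R t -> `|f t| <= b)%R ->
    (forall t : R, d < t -> f t = 0)%R -> rho phi f <= 1.
Proof.
move=> /Ces_nontrivial_mass[g [mg + [x0 [M [x00 M0 gM]]]]] b0 phib.
have := rho_ge0 hphi g; case Eg : (rho phi g) => [J| |]// J0 _.
rewrite lee_fin in J0.
have [B B0 EB] : exists2 B, (0 <= B)%R & phi b = B%:E.
  have := orlicz_ge0 hphi (ltW b0); case: (phi b) phib => // B _.
  by rewrite lee_fin; exists B.
(* The three parts of the bound are each made at most 1 / 3; d is the inverse
   of a sum that dominates all the constraints imposed on it. *)
pose h : R := (3 * (B + 1))^-1%R.
have h0 : (0 < h)%R by rewrite invr_gt0; lra.
have Bh : (B * h <= 3^-1)%R.
  by rewrite /h invfM mulrCA ler_piMr// ler_pdivrMr ?mul1r; lra.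
pose S := (1 + h^-1 + 3 * (B * x0 / h) + b / M + 3 * (b * J / M))%R.
have s1 : (0 < h^-1)%R by rewrite invr_gt0.
have s2 : (0 <= B * x0 / h)%R by rewrite divr_ge0 ?mulr_ge0// ltW.
have s3 : (0 < b / M)%R by rewrite divr_gt0.
have s4 : (0 <= b * J / M)%R by rewrite divr_ge0 ?mulr_ge0// ltW.
have S0 : (0 < S)%R by rewrite /S; lra.
pose d := (S^-1)%R.
have d0 : (0 < d)%R by rewrite invr_gt0.
have dS X : (X <= S)%R -> (d * X <= 1)%R.
  by move=> XS; rewrite /d mulrC ler_pdivrMr// mul1r.
have d1 : (d / h <= 1)%R by apply: dS; rewrite /S; lra.
have d2 : (d * (3 * (B * x0 / h)) <= 1)%R by apply: dS; rewrite /S; lra.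
have d3 : (d * (b / M) <= 1)%R by apply: dS; rewrite /S; lra.
have d4 : (d * (3 * (b * J / M)) <= 1)%R by apply: dS; rewrite /S; lra.
exists d => // f mf fb fd.
pose th := (d * (b / M))%R.
have th0 : (0 <= th)%R by rewrite mulr_ge0// ltW.
pose G x := th%:E * orlicz_ext phi (cesaro_op (fun t => `|g t|)%R x).
pose c2 := (d / h * B)%R.
have dh0 : (0 <= d / h)%R by rewrite divr_ge0// ltW.
have c20 : (0 <= c2)%R by rewrite mulr_ge0.
have G0 x : halfline R x -> 0 <= G x.
  by move=> xh; rewrite mule_ge0// ?lee_fin// (orlicz_cesaro_ge0 hphi).
have mG : measurable_fun (halfline R) G.
  by apply: emeasurable_funM; [exact: measurable_cst|
                               exact: (measurable_orlicz_cesaro hphi)].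
have mA := measurable_bump B h.
have mA2 := measurable_bump c2 x0.
have A0 x : halfline R x -> 0 <= bump B h x by move=> _; exact: bump_ge0.
have A20 x : halfline R x -> 0 <= bump c2 x0 x by move=> _; exact: bump_ge0.
have bound x : halfline R x ->
    orlicz_ext phi (cesaro_op (fun t => `|f t|)%R x) <=
    bump B h x + (bump c2 x0 x + G x).
  move=> xh; have xr : (0 <= x)%R by move: xh; rewrite /halfline/= in_itv/= andbT.
  have C0 := cesaro_ge0 f xh.
  have Cb : cesaro_op (fun t => `|f t|)%R x <= b%:E.
    rewrite /cesaro_op; apply: (@le_trans _ _ ((x : R)^-1%:E * (b * x)%:E)).
      by rewrite lee_wpmul2l ?lee_fin ?invr_ge0//; apply: primitive_bound_cst => //; exact: ltW.
    rewrite -EFinM lee_fin mulrCA ler_piMr// ?(ltW b0)//.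
    have [->|xn] := eqVneq (x : R) 0%R; first by rewrite mulr0.
    by rewrite mulVf.
  have Cbd : cesaro_op (fun t => `|f t|)%R x <= ((x : R)^-1 * (b * d))%:E.
    rewrite /cesaro_op EFinM lee_wpmul2l ?lee_fin ?invr_ge0//.
    by apply: primitive_bound => //; exact: ltW.
  have [xle|xgt] := leP (x : R) h.
    apply: (@le_trans _ _ (bump B h x)); last by rewrite leeDl// adde_ge0// ?A20 ?G0.
    by rewrite bumpE ?xr//= -EB; exact: (le_orlicz_ext hphi C0 Cb).
  have x_gt0 : (0 < (x : R))%R by exact: lt_trans xgt.
  apply: (@le_trans _ _ (bump c2 x0 x + G x)); last by rewrite leeDr// A0.
  have [xle0|xgt0] := leP (x : R) x0.
    apply: (@le_trans _ _ (bump c2 x0 x)); last by rewrite leeDl// G0.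
    rewrite bumpE ?xr//= /c2.
    apply: (@le_trans _ _ (phi (d / h * b)%R)).
      apply: (le_orlicz_ext hphi C0 (y := (d / h * b)%:E)).
      apply: (le_trans Cbd); rewrite lee_fin.
      rewrite mulrC mulrAC -[leRHS]mulrA [(h^-1 * b)%R]mulrC mulrA [(d * b)%R]mulrC.
      rewrite mulrAC ler_wpM2l ?mulr_ge0 ?(ltW b0) ?(ltW d0)//.
      by rewrite lef_pV2 ?posrE// ltW.
    rewrite EFinM -EB; apply: (orlicz_scale hphi); last exact: ltW.
    by rewrite dh0 d1.
  apply: (@le_trans _ _ (G x)); last by rewrite leeDr// A20.
  apply: (@le_trans _ _ (phi (th * (M / x))%R)).
    apply: (le_orlicz_ext hphi C0 (y := (th * (M / x))%:E)).
    apply: (le_trans Cbd); rewrite lee_fin le_eqVlt; apply/orP; left; apply/eqP.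
    by rewrite /th; field; rewrite !gt_eqF.
  have Mx0 : (0 <= M / x)%R by rewrite divr_ge0// ltW.
  apply: (@le_trans _ _ (th%:E * phi (M / x)%R)).
    by apply: (orlicz_scale hphi) => //; rewrite th0 d3.
  rewrite /G lee_wpmul2l ?lee_fin//.
  apply: (le_orlicz_ext hphi (x := (M / x)%:E)); first by rewrite lee_fin.
  rewrite /cesaro_op mulrC EFinM lee_wpmul2l ?lee_fin ?invr_ge0//.
  apply: (le_trans gM); apply: ge0_subset_integral.
  - exact: leb_measurable_itv.
  - exact: leb_measurable_itv.
  - exact: measurable_abs_itv.
  - by move=> t _; rewrite lee_fin.
  - by apply: subset_itvl; rewrite bnd_simp ltW.
have mH : measurable (halfline R) by exact: measurable_halfline.
have mAG : measurable_fun (halfline R) (fun x => bump c2 x0 x + G x).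
  by apply: emeasurable_funD.
have mphif := measurable_orlicz_cesaro hphi mf.
have AG0 x : halfline R x -> 0 <= bump c2 x0 x + G x.
  by move=> xh; rewrite adde_ge0 ?A20 ?G0.
rewrite rhoE; apply: le_trans (ge0_le_integral_add _ mH mA mAG mphif A0 AG0 _ bound) _.
  by move=> x xh; exact: (orlicz_cesaro_ge0 hphi).
rewrite integral_bump// ?(ltW h0)//.
apply: (@le_trans _ _ ((B * h)%:E + ((c2 * x0)%:E + th%:E * J%:E))).
  rewrite leeD2l// -integral_bump ?(ltW x00)//.
  apply: le_trans (ge0_le_integral_add _ mH mA2 mG mAG A20 G0 AG0 _) _; first by [].
  rewrite leeD2l// -Eg rhoE.
  have <- := ge0_integralZl (leb R) mH (measurable_orlicz_cesaro hphi mg)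
    (orlicz_cesaro_ge0 hphi g) (k := th%:E); first by [].
  by rewrite lee_fin.
rewrite -!EFinM -!EFinD lee_fin.
have e2 : (c2 * x0 <= 3^-1)%R.
  have : (d * (3 * (B * x0 / h)) = 3 * (c2 * x0))%R by rewrite /c2; field; rewrite gt_eqF.
  by move=> e; move: d2; rewrite e; lra.
have e3 : (th * J <= 3^-1)%R.
  have : (d * (3 * (b * J / M)) = 3 * (th * J))%R by rewrite /th; field; rewrite gt_eqF.
  by move=> e; move: d4; rewrite e; lra.
lra.
Qed.

(** Take the height b on every block: any dilation leaves the domain where phi is
    finite, so the modular becomes infinite, while F <= b 1_[0,d] has modular at
    most 1 once the blocks lie in [0, d]. *)
Lemma finite_value_linfty (b : R) : Ces_nontrivial phi -> (0 < b)%R ->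
  phi b < +oo -> (forall v : R, (b < v)%R -> phi v = +oo) ->
  contains_linfty_isometrically phi.
Proof.
move=> nontriv b0 phib phioo.
have [d d0 small] := small_support_rho nontriv b0 phib.
have [p [q [u [pq H]]]] : exists p q u : nat -> R, disjoint_blocks p q /\
    forall k, (2 * k.+2%:R * p k <= q k)%R /\ (u k = b /\ (q k <= d)%R).
  apply: (@lacunary_blocks _ (fun k L u => u = b /\ (L <= d)%R)); left => k e e0.
  exists (Num.min d e), b; rewrite lt_min d0 e0 !ge_min !lexx orbT.
  by split.
have [pq0 _] := pq.
have q0 k : (0 < q k)%R by have /andP[p0 pqk] := pq0 k; exact: le_lt_trans pqk.
have uE k : u k = b by have [_ []] := H k.
apply: (good_blocks_linfty (u := u) hphi pq).
- by move=> k; have [] := H k.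
- by move=> k; rewrite uE.
- move=> k; rewrite uE phioo; last by rewrite ltr_pMl// ltrDl.
  by rewrite gt0_muley ?leey// lte_fin.
apply: small; first exact: L0_block.
  move=> t _; have [[k tk]|nt] := pselect (exists k, (p k < (t : R) <= q k)%R).
    by rewrite (block_in _ pq tk) uE gtr0_norm.
  by rewrite (block_out _ nt) normr0 ltW.
move=> t dt; rewrite block_out// => -[k /andP[_ tq]].
by have [_ [_ qd]] := H k; have := lt_le_trans dt (le_trans tq qd); rewrite ltxx.
Qed.

End finite_case.


(** * The dichotomy *)

Theorem theorem4 (R : realType) (phi : R -> \bar R)
    (hphi : orlicz_function phi)
    (hab : orlicz_b phi < +oo -> orlicz_a phi < orlicz_b phi)
    (hCes : Ces_nontrivial phi) :
  ((orlicz_ext phi (orlicz_b phi) = +oo ->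
      exists2 D : R, (0 < D)%R & forall f : lebR R -> R, orlicz_class phi f ->
        rho phi f <= D%:E * orlicz_modular phi (fun t => (f t)%:E)) ->
    ~ Delta2 phi -> contains_linfty_isometrically phi)
  /\ (Delta2 phi -> ~ contains_linfty phi).
Proof.
split=> [hD nD2|]; last exact: Delta2_no_linfty.
have [phiboo|phib] := eqVneq (orlicz_ext phi (orlicz_b phi)) +oo.
  by have [D D0 rhoD] := hD phiboo; exact: (rho_le_modular_linfty hphi D0 rhoD nD2).
case bE : (orlicz_b phi) phib => [b| |]//= phib.
have b_ge v : (0 < v)%R -> phi v < +oo -> (v <= b)%R.
  by move=> v0 phiv; rewrite -lee_fin -bE; apply: ereal_sup_ubound; exists v.
have b0 : (0 < b)%R.
  have [v v0 phiv] := orlicz_notoo hphi.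
  by rewrite (lt_le_trans v0)// b_ge// ltey.
apply: (finite_value_linfty hphi hCes b0); first by rewrite ltey.
move=> v bv; apply/eqP; rewrite -leye_eq leNgt; apply/negP => /b_ge.
by rewrite leNgt bv => /(_ (lt_trans b0 bv)).
Qed.
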